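(* Let $V\in\mathbb{R}^{n\times n}$ be symmetric and let $T:\mathbb{R}^n\rightrightarrows\mathbb{R}^n$ be maximally $V$-comonotone with $\operatorname{zer}T$ nonempty. Let $P\in\mathbb{R}^{n\times n}$ be symmetric positive semidefinite such that $\eta_{\min}:=1+\lambda_{\min}(U^\top VPU)>0$, where $U$ is any matrix whose columns form an orthonormal basis of the range of $P$. Consider a sequence $(z^k,\bar z^k)_{k\in\mathbb{N}}$ generated by the relaxed preconditioned proximal point algorithm (PPPA) starting from $z^0\in\mathbb{R}^n$ with relaxation parameters $\lambda_k\in(0,2\eta_{\min})$ such that $\lambda_k(2\eta_{\min}-\lambda_k)\ge\kappa>0$ uniformly for all $k$. Then, for all $z^\star\in\operatorname{zer}T$, $$\operatorname{q}_P(z^N-\bar z^N)\le\frac{\operatorname{q}_P(z^0-z^\star)}{(N+1)\kappa}\qquad\text{and}\qquad \operatorname{q}_P(z^N-\bar z^N)=o\big(1/(N+1)\big).$$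
   Context: For $T:\mathbb{R}^n\rightrightarrows\mathbb{R}^n$ set-valued: $\operatorname{gph}T=\{(x,y):y\in Tx\}$, $\operatorname{zer}T=\{x:0\in Tx\}$. For a symmetric matrix $M$, $\operatorname{q}_M(x):=\langle x,Mx\rangle$. $T$ is $V$-comonotone ($V$ symmetric) if $\langle x-x',y-y'\rangle\ge\operatorname{q}_V(y-y')$ for all $(x,y),(x',y')\in\operatorname{gph}T$; it is maximally $V$-comonotone if moreover its graph is not strictly contained in the graph of another $V$-comonotone operator. (PPPA): $\bar z^k\in(P+T)^{-1}Pz^k$, $z^{k+1}=z^k+\lambda_k(\bar z^k-z^k)$. For a square matrix with real eigenvalues, $\lambda_{\min}$ is its smallest eigenvalue; $U^\top VPU$ has real eigenvalues (it is similar to a symmetric matrix). $a_N=o(1/(N+1))$ means $(N+1)a_N\to0$ as $N\to\infty$. *)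

(* Defs.v *)
From mathcomp Require Import all_boot all_order all_algebra.
From mathcomp Require Import all_classical all_reals all_analysis.
Set Implicit Arguments.
Unset Strict Implicit.
Unset Printing Implicit Defensive.
Import Order.TTheory GRing.Theory Num.Theory.
Import numFieldNormedType.Exports.
Local Open Scope classical_set_scope.
Local Open Scope ring_scope.

Section Quadratic.
Context {R : realType} {n : nat}.

Definition inner (x y : 'cV[R]_n) : R := (x^T *m y) ord0 ord0.

Definition qform (M : 'M[R]_n) (x : 'cV[R]_n) : R := inner x (M *m x).

Definition psd (M : 'M[R]_n) : Prop := forall x : 'cV[R]_n, 0 <= qform M x.

(* [eigenvalue] uses row eigenvectors, which gives the same eigenvalues as
   column eigenvectors.  Only eigenvalues in [R] are seen, so this is meant for
   matrices with real spectrum.  The default 0 is taken for the 0 x 0 matrix. *)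
Definition lambda_min (M : 'M[R]_n) : R :=
  xget 0 [set a | eigenvalue M a /\ forall b, eigenvalue M b -> a <= b].

(* Row spaces of transposes are column spaces: the columns of [U] span the
   range of [P]. *)
Definition orthonormal_range_basis (r : nat) (P : 'M[R]_n) (U : 'M[R]_(n, r)) :
    Prop :=
  U^T *m U = 1%:M /\ (U^T == P^T)%MS.

End Quadratic.

Definition eta_min {R : realType} {n r : nat} (V P : 'M[R]_n)
    (U : 'M[R]_(n, r)) : R :=
  1 + lambda_min (U^T *m V *m P *m U).

Section Operators.
Context {R : realType} {n : nat}.

Definition operator : Type := 'cV[R]_n -> set 'cV[R]_n.

Definition gph (T : operator) : set ('cV[R]_n * 'cV[R]_n) :=
  [set xy | T xy.1 xy.2].

Definition zer (T : operator) : set 'cV[R]_n := [set x | T x 0].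

Definition comonotone (V : 'M[R]_n) (T : operator) : Prop :=
  forall x y x' y' : 'cV[R]_n, gph T (x, y) -> gph T (x', y') ->
    qform V (y - y') <= inner (x - x') (y - y').

Definition maximally_comonotone (V : 'M[R]_n) (T : operator) : Prop :=
  comonotone V T /\
  ~ (exists S : operator, comonotone V S /\ gph T `<` gph S).

Definition op_mx (P : 'M[R]_n) : operator := fun x => [set P *m x].

Definition op_add (S T : operator) : operator :=
  fun x => [set u + v | u in S x & v in T x].

Definition op_inv (T : operator) : operator := fun y => [set x | T x y].

Definition PPPA (P : 'M[R]_n) (T : operator) (lam : nat -> R)
    (z zbar : nat -> 'cV[R]_n) : Prop :=
  forall k : nat,
    op_inv (op_add (op_mx P) T) (P *m z k) (zbar k) /\
    z k.+1 = z k + lam k *: (zbar k - z k).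

End Operators.

Arguments operator R n : clear implicits.

(* Main.v *)
Require Import Defs.
From mathcomp Require Import all_boot all_order all_algebra.
From mathcomp Require Import all_classical all_reals all_analysis.
From mathcomp Require Import ring lra.
Import Order.TTheory GRing.Theory Num.Theory.
Import numFieldNormedType.Exports.
Local Open Scope classical_set_scope.
Local Open Scope ring_scope.

(** Write d_k = z_k - zbar_k for the residual and eta for [eta_min V P U].  The
iteration says that P d_k belongs to T zbar_k, so comonotonicity can be used
between two iterates, or between an iterate and a zero of T.

The hypothesis on the eigenvalue enters once, through [lambda_min_range]:
<P d, V P d> >= (eta - 1) <d, P d> for every d.  This absorbs the possibly
negative term of comonotonicity: if P w is in T x and P w' is in T y, then
  <(x + w) - (y + w'), P (w - w')> >= eta q_P(w - w').
To prove it, compress everything to the range of P: with B = U^T P U, which is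
positive definite, and A = U^T V U, one has U^T V P U = A B, and the claim
becomes q_A(B x) >= lambda_min(A B) q_B(x).  The eigenvalues of A B are the
critical values of the Rayleigh quotient q_{BAB} / q_B, whose minimum is
attained by compactness ([lambda_min_rayleigh]).

Two consequences follow.  Against a zero zstar, with z_k = zbar_k + d_k,
  q_P(z_{k+1} - zstar) <= q_P(z_k - zstar) - lam_k (2 eta - lam_k) q_P(d_k)
                    <= q_P(z_k - zstar) - kappa q_P(d_k).
Between consecutive iterates, lam_k <d_k, P e> >= eta q_P(e) for
e = d_k - d_{k+1}, and expanding q_P(d_k - e) with lam_k < 2 eta shows that
q_P(d_k) is nonincreasing.

Everything else concerns real sequences.  If a is nonincreasing and
s_{k+1} <= s_k - kappa a_k with a and s nonnegative, then summing over
k = m, ..., N gives (N + 1 - m) kappa a_N <= s_m - s_{N+1}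
([telescoped_decrease]).  With m = 0 this is the explicit bound; with m the
half of N the right-hand side is a difference of two terms of a convergent
sequence, so it tends to 0, and (N + 1) a_N tends to 0 as well
([telescoped_decrease_little_o]). *)

(** * Inner products and quadratic forms *)

Section InnerTheory.
Context {R : realType} {n : nat}.
Implicit Types (x y w : 'cV[R]_n) (M N : 'M[R]_n).

Lemma innerC x y : inner x y = inner y x.
Proof.
rewrite /inner; have -> : y^T *m x = (x^T *m y)^T by rewrite trmx_mul trmxK.
by rewrite [RHS]mxE.
Qed.

Lemma innerDl x y w : inner (x + y) w = inner x w + inner y w.
Proof. by rewrite /inner linearD /= mulmxDl mxE. Qed.

Lemma innerNl x w : inner (- x) w = - inner x w.
Proof. by rewrite /inner linearN /= mulNmx mxE. Qed.

Lemma innerZl (a : R) x w : inner (a *: x) w = a * inner x w.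
Proof. by rewrite /inner linearZ /= -scalemxAl mxE. Qed.

Lemma innerDr w x y : inner w (x + y) = inner w x + inner w y.
Proof. by rewrite innerC innerDl !(innerC w). Qed.

Lemma innerNr w x : inner w (- x) = - inner w x.
Proof. by rewrite innerC innerNl (innerC w). Qed.

Lemma innerZr w (a : R) x : inner w (a *: x) = a * inner w x.
Proof. by rewrite innerC innerZl (innerC w). Qed.

Lemma qformBl M N x : qform (M - N) x = qform M x - qform N x.
Proof. by rewrite /qform mulmxBl innerDr innerNr. Qed.

Lemma qformZl (a : R) M x : qform (a *: M) x = a * qform M x.
Proof. by rewrite /qform -scalemxAl innerZr. Qed.

Lemma qform0 M : qform M 0 = 0.
Proof. by rewrite /qform mulmx0 /inner mulmx0 mxE. Qed.

Lemma inner_gt0 x : x != 0 -> 0 < inner x x.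
Proof.
move=> x0; have E : inner x x = \sum_i x i ord0 ^+ 2.
  by rewrite /inner mxE; apply: eq_bigr => i _; rewrite mxE expr2.
rewrite lt_neqAle E sumr_ge0 ?andbT; last by move=> i _; exact: sqr_ge0.
apply: contra x0 => /eqP/esym h; apply/eqP/colP => i; rewrite mxE.
have /(_ i isT) /eqP := psumr_eq0P (fun i _ => sqr_ge0 (x i ord0)) h.
by rewrite sqrf_eq0 => /eqP.
Qed.

End InnerTheory.

Lemma inner_mulmxr {R : realType} {m n : nat} (M : 'M[R]_(m, n))
    (x : 'cV[R]_m) (y : 'cV[R]_n) : inner x (M *m y) = inner (M^T *m x) y.
Proof. by rewrite /inner trmx_mul trmxK mulmxA. Qed.

Lemma qform_congr {R : realType} {m n : nat} (M : 'M[R]_m) (N : 'M[R]_(m, n))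
    (x : 'cV[R]_n) : qform (N^T *m M *m N) x = qform M (N *m x).
Proof. by rewrite /qform -!mulmxA inner_mulmxr trmxK. Qed.

Lemma qformB {R : realType} {n : nat} (M : 'M[R]_n) (hM : M^T = M)
    (x y : 'cV[R]_n) :
  qform M (x - y) = qform M x - 2 * inner x (M *m y) + qform M y.
Proof.
rewrite /qform mulmxBr !(innerDl, innerDr, innerNl, innerNr).
by rewrite (inner_mulmxr M y x) hM (innerC (M *m y)); ring.
Qed.

Lemma qformZ {R : realType} {n : nat} (M : 'M[R]_n) (a : R) (x : 'cV[R]_n) :
  qform M (a *: x) = a ^+ 2 * qform M x.
Proof. by rewrite /qform -scalemxAr innerZl innerZr mulrA expr2. Qed.

(** With q_M(x) = 0, the function t |-> q_M(x - t M x) is nonnegative, vanishes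
at t = 0 and has slope -2 |M x|^2 there, which forces M x = 0. *)
Lemma psd_qform_eq0 {R : realType} {n : nat} (M : 'M[R]_n) (hM : M^T = M)
    (Mpsd : psd M) (x : 'cV[R]_n) : qform M x = 0 -> M *m x = 0.
Proof.
move=> qx; apply/eqP/negPn/negP => Mx0.
set a := inner (M *m x) (M *m x).
have a0 : 0 < a by exact: inner_gt0.
set b := qform M (M *m x).
have b0 : 0 <= b by exact: Mpsd.
have h t : 0 <= - 2 * t * a + t ^+ 2 * b.
  have := Mpsd (x - t *: (M *m x)).
  rewrite qformB // qx qformZ -scalemxAr innerZr inner_mulmxr hM -/a -/b; lra.
(* The minimizer a / b is not available when b = 0; the step a / (b + 1) still
   makes the quadratic function negative. *)
have b1 : 0 < b + 1 by lra.
have := h (a / (b + 1)).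
have -> : - 2 * (a / (b + 1)) * a + (a / (b + 1)) ^+ 2 * b
   = - (a ^+ 2 * (b + 2) / (b + 1) ^+ 2) by field; rewrite gt_eqF.
rewrite oppr_ge0 leNgt => /negP; apply.
by rewrite divr_gt0 ?mulr_gt0 ?exprn_gt0 //; lra.
Qed.

(** * The smallest eigenvalue as the minimum of a Rayleigh quotient *)

Lemma qformE {R : realType} {n : nat} (M : 'M[R]_n) (x : 'cV[R]_n) :
  qform M x = \sum_i x i ord0 * \sum_j M i j * x j ord0.
Proof.
by rewrite /qform /inner mxE; apply: eq_bigr => i _; rewrite !mxE.
Qed.

Lemma sum_continuous {R : realType} {T : topologicalType} {I : Type}
    (r : seq I) (F : I -> T -> R) :
  (forall i, continuous (F i)) -> continuous (fun x => \sum_(i <- r) F i x).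
Proof.
move=> Fc x; elim: r => [|i r IHr].
  by rewrite (_ : (fun x => _) = cst 0);
    [exact: cvg_cst | apply/funext => y; rewrite big_nil].
rewrite (_ : (fun x => _) = F i \+ (fun x => \sum_(i <- r) F i x)).
  by apply: cvgD => //; exact: Fc.
by apply/funext => y; rewrite big_cons.
Qed.

(** Stated on row vectors, the space in which the unit sphere is minimized over
in [rayleigh_min_attained]. *)
Lemma qform_tr_continuous {R : realType} {n : nat} (M : 'M[R]_n) :
  continuous (fun v : 'rV[R]_n => qform M v^T).
Proof.
have -> : (fun v : 'rV[R]_n => qform M v^T)
   = (fun v : 'rV[R]_n => \sum_i v ord0 i * \sum_j M i j * v ord0 j).
  apply/funext => u; rewrite qformE; apply: eq_bigr => i _; rewrite mxE.
  by congr (_ * _); apply: eq_bigr => j _; rewrite mxE.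
have coordc i := @coord_continuous R 1 n ord0 i.
apply: sum_continuous => i v.
apply: (@continuousM _ _ (fun v : 'rV[R]_n => v ord0 i)); first exact: coordc.
apply: sum_continuous => j {}v.
apply: (@continuousM _ _ (fun=> M i j)); first exact: cst_continuous.
exact: coordc.
Qed.

(** The quotient is invariant under scaling, so its infimum is its minimum over
the unit sphere, which is compact.  The witness [y] only says that the
dimension is positive. *)
Lemma rayleigh_min_attained {R : realType} {n : nat} (C B : 'M[R]_n)
    (Bpd : forall x : 'cV[R]_n, x != 0 -> 0 < qform B x) (y : 'cV[R]_n) :
  y != 0 -> exists2 x0 : 'cV[R]_n, x0 != 0 &
    forall x : 'cV[R]_n, qform C x0 / qform B x0 * qform B x <= qform C x.
Proof.
move=> y0.
pose S : set 'rV[R]_n := [set v | `|v| = 1].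
have normalize (x : 'cV[R]_n) : x != 0 -> S (`|x^T|^-1 *: x^T).
  move=> x0; rewrite /S/= normrZ normfV normr_id mulVf //.
  by rewrite normr_eq0 trmx_eq0.
have Sn0 v : S v -> v != 0.
  apply: contraPneq => ->; rewrite /S/= normr0 => /eqP.
  by rewrite eq_sym oner_eq0.
have cS : compact S.
  apply: bounded_closed_compact.
    exists 1; split; first exact: num_real.
    by move=> x x1 v /= ->; exact: ltW.
  apply: (preimage_closed (f := fun v : 'rV[R]_n => `|v|)) (@closed_eq R 1).
  by move=> v _; exact: norm_continuous.
have [|//|v vS vmin] := @EVT_min_rV R n
    (fun v => qform C v^T / qform B v^T) S _ cS.
- by exists (`|y^T|^-1 *: y^T); exact: normalize.
- apply: continuous_in_subspaceT => v /set_mem /Sn0 v0.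
  apply: (@continuousM _ _ (fun v : 'rV[R]_n => qform C v^T)).
    exact: qform_tr_continuous.
  apply: (@continuousV _ _ (fun v : 'rV[R]_n => qform B v^T)).
    by rewrite gt_eqF // Bpd // trmx_eq0.
  exact: qform_tr_continuous.
exists v^T; first by rewrite trmx_eq0 Sn0 //; exact/set_mem.
move=> x; have [->|x0] := eqVneq x 0.
  by rewrite !(mulmx0, qform0) mulr0.
rewrite -ler_pdivlMr ?Bpd //.
apply: le_trans (vmin _ (mem_set (normalize x x0))) _.
rewrite linearZ /= trmxK !qformZ -mulf_div divff ?mul1r //.
by rewrite sqrf_eq0 invr_eq0 normr_eq0 trmx_eq0.
Qed.

Lemma lambda_minE {R : realType} {n : nat} (M : 'M[R]_n) (a : R) :
    eigenvalue M a -> (forall b, eigenvalue M b -> a <= b) ->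
  lambda_min M = a.
Proof.
move=> Ma amin; rewrite /lambda_min.
have [Ml lmin] : [set a | eigenvalue M a /\ forall b, eigenvalue M b -> a <= b]
    (lambda_min M) by apply: xgetPex; exists a.
by apply/le_anti; rewrite amin // lmin.
Qed.

(** The minimum mu of q_{BAB} / q_B, attained at w, is the smallest eigenvalue
of A B.  Indeed BAB - mu B is positive semidefinite and its form vanishes at w,
so BAB w = mu B w, which says that the row (B w)^T is an eigenvector of A B.
Conversely, any row eigenvector of A B can be written (B u)^T, and then its
eigenvalue is the value of the quotient at u, hence at least mu. *)
Lemma lambda_min_rayleigh {R : realType} {n : nat} (A B : 'M[R]_n)
    (hA : A^T = A) (hB : B^T = B)
    (Bpd : forall x : 'cV[R]_n, x != 0 -> 0 < qform B x) (x : 'cV[R]_n) :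
  lambda_min (A *m B) * qform B x <= qform A (B *m x).
Proof.
have [->|x0] := eqVneq x 0.
  by rewrite !(mulmx0, qform0) mulr0.
pose C := B^T *m A *m B.
have CE w : qform C w = qform A (B *m w) by rewrite /C qform_congr.
have [w w0] := rayleigh_min_attained C B Bpd x x0.
set mu := _ / _ => mu_min.
have Bw0 : 0 < qform B w by exact: Bpd.
have kerB (v : 'cV[R]_n) : B *m v = 0 -> v = 0.
  move=> Bv; apply/eqP/negPn/negP => /Bpd.
  by rewrite /qform Bv /inner mulmx0 mxE ltxx.
have Dw : (C - mu *: B) *m w = 0.
  apply: psd_qform_eq0.
  - by rewrite linearB linearZ /= /C !trmx_mul trmxK hA hB mulmxA.
  - by move=> v; rewrite qformBl qformZl subr_ge0.
  - by rewrite qformBl qformZl /mu divfK ?subrr // gt_eqF.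
have Cw : C *m w = mu *: (B *m w).
  by apply/eqP; rewrite -subr_eq0 -Dw mulmxBl scalemxAl.
have Emu : eigenvalue (A *m B) mu.
  apply/eigenvalueP; exists (B *m w)^T.
    by rewrite -linearZ /= -Cw /C !trmx_mul hA !hB !mulmxA.
  by rewrite trmx_eq0; apply: contra w0 => /eqP/kerB ->.
rewrite (lambda_minE (A *m B) mu) -?CE // => b /eigenvalueP[v vAB v0].
have Bu : B \in unitmx.
  rewrite -row_free_unit -kermx_eq0; apply/eqP/row_matrixP => i.
  apply: (can_inj trmxK); rewrite row0 trmx0; apply: kerB.
  rewrite -{1}hB -trmx_mul; apply: (can_inj trmxK).
  by rewrite trmxK trmx0; apply/sub_kermxP/row_sub.
pose u := invmx B *m v^T.
have BuE : B *m u = v^T by rewrite /u mulKVmx.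
have u0 : u != 0.
  by apply: contra v0 => /eqP u0; rewrite -trmx_eq0 -BuE u0 mulmx0.
have Cub : qform C u = b * qform B u.
  have vE : v *m (A *m (B *m u)) = b *: (v *m u).
    by rewrite (mulmxA A) mulmxA vAB scalemxAl.
  by rewrite CE /qform (innerC u) BuE /inner trmxK -BuE vE mxE.
by rewrite -(ler_pM2r (Bpd _ u0)) -Cub.
Qed.

(** * Rates for a telescoping decrease *)

(** Summing [sdecr] from m to m + p bounds kappa times the sum of the a_k, and
each of these p + 1 terms is at least the last one. *)
Lemma telescoped_decrease {R : realType} (kappa : R) (a s : nat -> R)
    (hk : 0 < kappa)
    (adecr : forall k, a k.+1 <= a k)
    (sdecr : forall k, s k.+1 <= s k - kappa * a k) (m p : nat) :
  p.+1%:R * (kappa * a (m + p)%N) <= s m - s (m + p).+1.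
Proof.
elim: p => [|p IHp].
  by rewrite addn0 mul1r; have := sdecr m; lra.
rewrite addnS -natr1 mulrDl mul1r.
have h1 : p.+1%:R * (kappa * a (m + p).+1) <= p.+1%:R * (kappa * a (m + p)%N).
  by rewrite ler_wpM2l // ler_wpM2l // ltW.
have := sdecr (m + p).+1; lra.
Qed.

Lemma cvgn_half : (N./2 @[N --> \oo] --> \oo)%N.
Proof.
apply/cvgnyPge => A; exists A.*2 => // N /= AN.
by rewrite -(doubleK A) half_leq.
Qed.

(** Telescoping over the second half of 0, ..., N leaves at least (N + 1) / 2
terms, while s_{N/2} - s_{N+1} tends to 0 because s converges. *)
Lemma telescoped_decrease_little_o {R : realType} (kappa : R) (a s : nat -> R)
    (hk : 0 < kappa) (a0 : forall k, 0 <= a k) (s0 : forall k, 0 <= s k)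
    (adecr : forall k, a k.+1 <= a k)
    (sdecr : forall k, s k.+1 <= s k - kappa * a k) :
  (N.+1%:R * a N) @[N --> \oo] --> (0 : R).
Proof.
have scvg : cvgn s.
  apply: nonincreasing_is_cvgn; last by exists 0 => _ [k _ <-].
  apply/nonincreasing_seqP => k; apply: (le_trans (sdecr k)).
  by rewrite gerBl mulr_ge0 // ltW.
pose b N := 2 / kappa * (s N./2 - s N.+1).
have b0 : b N @[N --> \oo] --> (0 : R).
  rewrite -[0 in X in _ --> X](mulr0 (2 / kappa)) -(subrr (limn s)).
  apply: cvgM; first exact: cvg_cst.
  apply: cvgB; first exact: (cvg_comp _ _ cvgn_half scvg).
  by rewrite (cvg_shiftS s).
apply: (@squeeze_cvgr _ _ _ _ (fun=> 0) b) b0; last exact: cvg_cst.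
apply: nearW => N; rewrite mulr_ge0 //= /b.
have hN : (N./2 + (N - N./2) = N)%N.
  by rewrite subnKC // -{2}(odd_double_half N) -addnn addnCA leq_addr.
have := telescoped_decrease _ _ _ hk adecr sdecr N./2 (N - N./2).
rewrite hN => h.
have hN2 : N.+1%:R <= 2 * (N - N./2).+1%:R :> R.
  rewrite -natrM ler_nat -{1}hN; have : (N./2 <= N - N./2)%N.
    by rewrite leq_subRL ?addnn -{2}(odd_double_half N) ?leq_addl //
      -addnn addnCA leq_addr.
  move: (N./2) (N - N./2)%N => u v uv.
  by rewrite mul2n -addnn addSn ltnS addnS leqW // leq_add2r.
rewrite mulrAC ler_pdivlMr //.
apply: le_trans (_ : 2 * ((N - N./2).+1%:R * (kappa * a N)) <= _); last lra.
rewrite (mulrA 2) -(mulrA _ (a N)) (mulrC (a N)).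
by rewrite ler_wpM2r // mulr_ge0 // ltW.
Qed.

(** * Compression to the range of the preconditioner *)

Section RangeCompression.
Context {R : realType} {n r : nat} {P : 'M[R]_n} {U : 'M[R]_(n, r)}.
Context (hPsym : P^T = P) (hU : orthonormal_range_basis P U).

Lemma range_projector : U *m U^T *m P = P.
Proof.
have [UU /andP[_ /submxP[Y hY]]] := hU.
have -> : P = U *m Y^T by apply: (can_inj trmxK); rewrite hY trmx_mul trmxK.
by rewrite mulmxA -(mulmxA U) UU mulmx1.
Qed.

Lemma range_projector_r : P *m U *m U^T = P.
Proof.
by apply: (can_inj trmxK); rewrite !trmx_mul trmxK hPsym mulmxA range_projector.
Qed.

(** The kernel of P is orthogonal to its range, so P U x = 0 implies
x = U^T (U x) = 0. *)
Lemma compression_pd (hPpsd : psd P) (x : 'cV[R]_r) :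
  x != 0 -> 0 < qform (U^T *m P *m U) x.
Proof.
move=> x0; rewrite qform_congr lt_neqAle hPpsd andbT.
apply: contra x0 => /eqP/esym/(psd_qform_eq0 P hPsym hPpsd) PUx.
have [UU /andP[/submxP[Y hY] _]] := hU.
by rewrite -[x]mul1mx -UU -mulmxA hY -mulmxA hPsym PUx mulmx0.
Qed.

(** Since U U^T P = P = P U U^T, the matrix U^T V P U factors as
(U^T V U) (U^T P U), and both sides are forms evaluated at U^T d. *)
Lemma lambda_min_range {V : 'M[R]_n} (hV : V^T = V) (hPpsd : psd P)
    (d : 'cV[R]_n) :
  lambda_min (U^T *m V *m P *m U) * qform P d <= qform V (P *m d).
Proof.
have PE : U *m (U^T *m P *m U) *m U^T = P.
  by rewrite !mulmxA range_projector range_projector_r.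
have ME : U^T *m V *m P *m U = (U^T *m V *m U) *m (U^T *m P *m U).
  by rewrite -[in LHS]range_projector !mulmxA.
have h1 : qform P d = qform (U^T *m P *m U) (U^T *m d).
  by rewrite -[in LHS]PE -(qform_congr _ U^T) trmxK.
have h2 : qform V (P *m d)
    = qform (U^T *m V *m U) ((U^T *m P *m U) *m (U^T *m d)).
  by rewrite [RHS]qform_congr -[in LHS]PE !mulmxA.
rewrite ME h1 h2; apply: lambda_min_rayleigh.
- by rewrite !trmx_mul trmxK hV mulmxA.
- by rewrite !trmx_mul trmxK hPsym mulmxA.
- exact: compression_pd.
Qed.

End RangeCompression.

(** * Convergence of the relaxed preconditioned proximal point algorithm *)

Theorem theorem2p11 (R : realType) (n : nat) (V : 'M[R]_n) (T : operator R n)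
    (P : 'M[R]_n) (r : nat) (U : 'M[R]_(n, r)) (lam : nat -> R) (kappa : R)
    (z zbar : nat -> 'cV[R]_n)
    (hV : V^T = V)
    (hT : maximally_comonotone V T)
    (hzer : zer T !=set0)
    (hPsym : P^T = P)
    (hPpsd : psd P)
    (hU : orthonormal_range_basis P U)
    (heta : 0 < eta_min V P U)
    (hz : PPPA P T lam z zbar)
    (hlam : forall k : nat, 0 < lam k < 2 * eta_min V P U)
    (hkappa : 0 < kappa)
    (hlamkappa : forall k : nat,
        kappa <= lam k * (2 * eta_min V P U - lam k)) :
  forall zstar : 'cV[R]_n, zer T zstar ->
    (forall N : nat,
        qform P (z N - zbar N) <=
          qform P (z 0%N - zstar) / (N.+1%:R * kappa)) /\
    (N.+1%:R * qform P (z N - zbar N)) @[N --> \oo] --> (0 : R).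
Proof.
move=> zs Tzs; have [Tmon _] := hT.
set eta := eta_min V P U in heta hlam hlamkappa *.
pose d k := z k - zbar k.
have Td k : T (zbar k) (P *m d k).
  have [[u -> [v Tv uv]] _] := hz k.
  suff -> : P *m d k = v by [].
  by rewrite /d mulmxBr -uv addrAC subrr add0r.
have zS k : z k.+1 = z k - lam k *: d k.
  by have [_ ->] := hz k; rewrite /d -scalerN opprB.
have zE k : zbar k + d k = z k by rewrite /d addrC subrK.
have cocoercive x y w w' : T x (P *m w) -> T y (P *m w') ->
    eta * qform P (w - w') <= inner ((x + w) - (y + w')) (P *m (w - w')).
  move=> Tx Ty; have := Tmon _ _ _ _ Tx Ty.
  rewrite -mulmxBr => h; have := lambda_min_range hPsym hU hV hPpsd (w - w').
  rewrite /eta /eta_min; move: (lambda_min _) => mu h'.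
  have -> : x + w - (y + w') = (x - y) + (w - w') by rewrite opprD addrACA.
  rewrite innerDl -/(qform P (w - w')); lra.
have step k :
    qform P (z k.+1 - zs) <= qform P (z k - zs) - kappa * qform P (d k).
  (* A zero zs of T pairs with the residual 0, as P 0 = 0. *)
  have := cocoercive (zbar k) zs (d k) 0 (Td k).
  rewrite mulmx0 => /(_ Tzs); rewrite !subr0 addr0 zE => h.
  rewrite zS addrAC (qformB P hPsym _ (lam k *: _)) qformZ -scalemxAr innerZr.
  have /andP[l0 _] := hlam k.
  have := ler_wpM2r (hPpsd (d k)) (hlamkappa k).
  have := ler_wpM2l (ltW l0) h; lra.
have ddecr k : qform P (d k.+1) <= qform P (d k).
  have := cocoercive _ _ _ _ (Td k) (Td k.+1).
  rewrite !zE.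
  have -> : z k - z k.+1 = lam k *: d k by rewrite zS opprB addrC subrK.
  rewrite innerZl => h.
  have -> : d k.+1 = d k - (d k - d k.+1) by rewrite opprB addrC subrK.
  rewrite qformB //; set e := d k - d k.+1 in h *.
  have /andP[l0 l2] := hlam k.
  (* Multiplied by lam_k, the difference of the two sides is at least
     (2 eta - lam_k) q_P(e). *)
  rewrite -(ler_pM2l l0).
  have := mulr_ge0 (ltW (eqbRL (subr_gt0 _ _) l2)) (hPpsd e); lra.
have s0 k : 0 <= qform P (z k - zs) by exact: hPpsd.
split=> [N|]; last first.
  exact: (telescoped_decrease_little_o _ _ _ hkappa (fun k => hPpsd (d k))
    s0 ddecr step).
rewrite ler_pdivlMr ?mulr_gt0 // mulrC -mulrA.
have := telescoped_decrease _ _ _ hkappa ddecr step 0 N.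
by rewrite add0n => /le_trans; apply; rewrite gerBl.
Qed.
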